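(* Let $(A,p,0,1)$ be a set $A$ with a ternary operation $p:A\times A\times A\to A$ and two constants $0,1\in A$ satisfying axioms (T1)--(T4). For $a\cdot b=p(0,a,b)$, $a\circ b=p(a,b,1)$ and $\bar a=p(1,a,0)$, the following conditions are equivalent: (i) the system $(A,\circ,\cdot,\overline{()},0,1)$ is a de Morgan algebra; (ii) the system $(A,\circ,\cdot)$ is a distributive lattice; (iii) $(A,\circ)$ is a join-semilattice; (iv) $(A,\cdot)$ is a meet-semilattice; (v) $(A,\circ)$ is an idempotent and commutative magma; (vi) $(A,\cdot)$ is an idempotent and commutative magma; (vii) $p(a,b,c)=(\bar b\cdot a)\circ(a\cdot c)\circ(b\cdot c)$ for all $a,b,c\in A$; (viii) $p(a,b,c)=(\bar b\circ c)\cdot(b\circ a)\cdot(a\circ c)$ for all $a,b,c\in A$.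
   Context: Axioms, for all $a,b,c,b_1,b_2,b_3\in A$: (T1) $p(0,a,1)=a$; (T2) $p(a,0,b)=a=p(b,1,a)$; (T3) $p(a,b,a)=a$; (T4) $p(a,p(b_1,b_2,b_3),c)=p(p(a,b_1,c),b_2,p(a,b_3,c))$. Under these axioms $\cdot$ and $\circ$ are associative, so iterated products need no parentheses. A de Morgan algebra is a bounded distributive lattice (meet $\cdot$, join $\circ$, bottom $0$, top $1$) together with an involution $\overline{()}$ (i.e. $\overline{\overline a}=a$) satisfying $\overline{a\cdot b}=\bar b\circ\bar a$ for all $a,b$ (equivalently $\overline{a\circ b}=\bar b\cdot\bar a$). A join-semilattice (respectively meet-semilattice) is a set with an associative, commutative and idempotent binary operation. A magma is a set with a binary operation. *)

(* Defs.v *)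
From mathcomp Require Import all_boot.
Set Implicit Arguments.
Unset Strict Implicit.
Unset Printing Implicit Defensive.

Section AlgebraicStructures.
Context {A : Type}.
Implicit Types (op join meet : A -> A -> A) (compl : A -> A) (bot top : A).

Definition idempotent_commutative_magma op : Prop :=
  idempotent_op op /\ commutative op.

(* Algebraically, join- and meet-semilattices satisfy the same axioms; only the
   order read off from the operation differs. *)
Record semilattice op : Prop := Semilattice {
  semilattice_assoc : associative op;
  semilattice_comm  : commutative op;
  semilattice_idem  : idempotent_op op }.

Record lattice join meet : Prop := Lattice {
  lattice_join : semilattice join;
  lattice_meet : semilattice meet;
  lattice_joinK : forall a b, join a (meet a b) = a;
  lattice_meetK : forall a b, meet a (join a b) = a }.

(* The dual distributive law is derivable in any lattice. *)
Record distributive_lattice join meet : Prop := DistributiveLattice {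
  distributive_lattice_lattice : lattice join meet;
  distributive_lattice_distr : right_distributive meet join }.

Record bounded_distributive_lattice join meet bot top : Prop :=
  BoundedDistributiveLattice {
  bounded_distributive_lattice_distr : distributive_lattice join meet;
  bounded_distributive_lattice_bot : forall a, join bot a = a;
  bounded_distributive_lattice_top : forall a, meet a top = a }.

Record de_morgan_algebra join meet compl bot top : Prop := DeMorganAlgebra {
  de_morgan_lattice : bounded_distributive_lattice join meet bot top;
  de_morgan_involutive : involutive compl;
  de_morgan_law : forall a b, compl (meet a b) = join (compl b) (compl a) }.

End AlgebraicStructures.

Section TernaryAlgebra.
Context {A : Type}.
Variables (p : A -> A -> A -> A) (zero one : A).

Record ternary_algebra : Prop := TernaryAlgebra {
  ternary_T1 : forall a, p zero a one = a;
  ternary_T2 : forall a b, p a zero b = a /\ p b one a = a;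
  ternary_T3 : forall a b, p a b a = a;
  ternary_T4 : forall a b1 b2 b3 c,
    p a (p b1 b2 b3) c = p (p a b1 c) b2 (p a b3 c) }.

Definition tmeet (a b : A) : A := p zero a b.
Definition tjoin (a b : A) : A := p a b one.
Definition tcompl (a : A) : A := p one a zero.

End TernaryAlgebra.

(* Main.v *)
Require Import Defs.
From mathcomp Require Import all_boot.

(** Read [p a b c] as: if [b] then [c] else [a].  Axiom (T4) says that a
    conditional whose test is itself a conditional may be evaluated by cases.
    Put [p 1 b 0] in the test: swapping the branches amounts to complementing
    the test ([p_compl]).  Hence complementation is an involution satisfying de
    Morgan's law, with no assumption on the operations, and it exchanges
    join and meet, so commutativity and idempotence pass from one to the other.

    Suppose that join and meet are commutative and idempotent.  Evaluating
    [a \/ (b /\ a)] by (T4) gives [p a b a], which is [a] by (T3): absorption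
    ([join_meetKr]).  Evaluating the two sides of the distributive law in the
    same way gives [p (b /\ a) c a] for both, so [A] is a de Morgan algebra
    ([de_morgan_of_meet]).

    For the formula writing [p a b c] as a join of meets, note that
    [a \/ (b /\ c) = p a b (a \/ c)] always holds, so that
    [p a b c = a \/ (b /\ c)] whenever [a] is below [c].  Meeting [p a b c] with
    [c], or with [a], reduces to this ordered case; and [p a b c] lies below
    [a \/ c], so distributivity recovers it as the join of these two meets
    ([p_join_of_meets]).

    Conversely, setting some arguments to constants in that formula, or in the
    one writing [p a b c] as a meet of joins, yields idempotence and
    commutativity ([join_magma_of_p_eq], [meet_magma_of_p_eq]).  The second
    formula is, up to the order of its factors, the first one for the algebra
    with reversed branches [p c b a] and exchanged constants. *)

Section TernaryTheory.
Context {A : Type} {p : A -> A -> A -> A} {zero one : A}.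
Context (Hp : ternary_algebra p zero one).

Local Notation meet := (tmeet p zero).
Local Notation join := (tjoin p one).
Local Notation compl := (tcompl p zero one).

Let T1 a : p zero a one = a. Proof. by case: Hp. Qed.
Let T20 a b : p a zero b = a. Proof. by case: Hp => _ /(_ a b) []. Qed.
Let T21 a b : p b one a = a. Proof. by case: Hp => _ /(_ a b) []. Qed.
Let T3 a b : p a b a = a. Proof. by case: Hp. Qed.
Let T4 a b1 b2 b3 c : p a (p b1 b2 b3) c = p (p a b1 c) b2 (p a b3 c).
Proof. by case: Hp. Qed.

(** * Identities that hold in every ternary algebra *)

(** In this dual algebra [tmeet] is [tjoin] with its arguments exchanged, and
    conversely, while the complement is the same function. *)
Lemma ternary_dual : ternary_algebra (fun a b c => p c b a) one zero.
Proof. by split=> // a b; split. Qed.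

Lemma p_compl a b c : p a (compl b) c = p c b a.
Proof. by rewrite /tcompl T4 T20 T21. Qed.

Lemma compl_involutive : involutive compl.
Proof. by move=> a; rewrite {1}/tcompl p_compl T1. Qed.

Lemma compl_meet a b : compl (meet a b) = join (compl b) (compl a).
Proof. by rewrite /tjoin p_compl {1}/tcompl /tmeet T4 T20. Qed.

Lemma compl_join a b : compl (join a b) = meet (compl b) (compl a).
Proof. by apply: (can_inj compl_involutive); rewrite compl_meet !compl_involutive. Qed.

Lemma compl0 : compl zero = one. Proof. exact: T20. Qed.
Lemma meet0l a : meet zero a = zero. Proof. exact: T20. Qed.
Lemma meet1l a : meet one a = a. Proof. exact: T21. Qed.
Lemma meet1r a : meet a one = a. Proof. exact: T1. Qed.
Lemma join0l a : join zero a = a. Proof. exact: T1. Qed.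
Lemma join0r a : join a zero = a. Proof. exact: T20. Qed.
Lemma join1l a : join one a = one. Proof. exact: T3. Qed.
Lemma join1r a : join a one = one. Proof. exact: T21. Qed.

Lemma meetA : associative meet.
Proof. by move=> a b c; rewrite /tmeet T4 T20. Qed.

Lemma joinA : associative join.
Proof. by move=> a b c; rewrite /tjoin T4 T21. Qed.

Lemma meet_p a b c t : meet (p a b c) t = p (meet a t) b (meet c t).
Proof. exact: T4. Qed.

Lemma join_meet a b c : join a (meet b c) = p a b (join a c).
Proof. by rewrite /tjoin /tmeet T4 T20. Qed.

Lemma join_meetKr a b : idempotent_op join -> join a (meet b a) = a.
Proof. by move=> joinxx; rewrite join_meet joinxx T3. Qed.

Lemma magma_join_meet :
  idempotent_commutative_magma join -> idempotent_commutative_magma meet.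
Proof.
case=> joinxx joinC; split=> [a | a b]; apply: (can_inj compl_involutive).
  by rewrite compl_meet joinxx.
by rewrite !compl_meet joinC.
Qed.

Lemma magma_meet_join :
  idempotent_commutative_magma meet -> idempotent_commutative_magma join.
Proof.
case=> meetxx meetC; split=> [a | a b]; apply: (can_inj compl_involutive).
  by rewrite compl_join meetxx.
by rewrite !compl_join meetC.
Qed.

(** * Commutative idempotent operations give a de Morgan algebra *)

Lemma de_morgan_of_meet :
  idempotent_commutative_magma meet ->
  de_morgan_algebra join meet compl zero one.
Proof.
move=> magma_meet; have [meetxx meetC] := magma_meet.
have [joinxx joinC] := magma_meet_join magma_meet.
have join_meetK a b : join a (meet a b) = a by rewrite meetC join_meetKr.
have meet_joinK a b : meet a (join a b) = a.
  apply: (can_inj compl_involutive).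
  by rewrite compl_meet compl_join joinC meetC join_meetK.
split; [split; [split | exact: join0l | exact: meet1r]
       | exact: compl_involutive | exact: compl_meet].
  by split=> //; split=> //; [exact: joinA | exact: meetA].
move=> a b c; rewrite (meetC a (join b c)) meet_p meet1l (meetC a c) join_meet.
by rewrite (joinC (meet a b)) join_meetK (meetC b).
Qed.

(** The meets of [p a b c] with [a] and with [c] have comparable outer
    arguments, which is where [join_meet] computes [p]; the claim joins them. *)
Lemma p_join_of_meets :
  idempotent_commutative_magma meet -> forall a b c,
  p a b c = join (join (meet (compl b) a) (meet a c)) (meet b c).
Proof.
move=> magma_meet a b c; have [meetxx meetC] := magma_meet.
have [joinxx joinC] := magma_meet_join magma_meet.
have [[[[_ _ joinK meetK] distr] _ _] _ _] := de_morgan_of_meet magma_meet.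
have p_le u v w : join u w = w -> p u v w = join u (meet v w).
  by rewrite join_meet => ->.
have p_meetr : meet (p a b c) c = join (meet a c) (meet b c).
  by rewrite meet_p meetxx p_le // joinC meetC joinK.
have p_meetl : meet (p a b c) a = join (meet a c) (meet (compl b) a).
  by rewrite meet_p meetxx (meetC c) -p_compl p_le // joinC joinK.
have -> : p a b c = meet (p a b c) (join a c).
  by rewrite meet_p meetK (joinC a) meetK.
rewrite distr p_meetl p_meetr (joinC (meet a c) (meet _ a)).
by rewrite -joinA (joinA (meet a c)) joinxx joinA.
Qed.

(** * Each formula forces commutativity and idempotence *)

Lemma join_magma_of_p_eq :
  (forall a b c,
     p a b c = join (join (meet (compl b) a) (meet a c)) (meet b c)) ->
  idempotent_commutative_magma join.
Proof.
move=> p_eq; have joinxx a : join a a = a.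
  by have := p_eq a zero one; rewrite T20 compl0 meet1l meet1r meet0l join0r.
split=> // a b.
(* Complementing [b] turns [join a b] into [p one _ a], whose expansion ends in
   a term absorbed by [a]. *)
rewrite -[b]compl_involutive {1}/tjoin p_compl p_eq meet1r meet1l.
by rewrite -joinA join_meetKr.
Qed.

Lemma meet_magma_of_p_eq :
  (forall a b c,
     p a b c = meet (meet (join (compl b) c) (join b a)) (join a c)) ->
  idempotent_commutative_magma meet.
Proof.
move=> p_eq; apply: magma_join_meet.
have joinC : commutative join.
  by move=> a b; rewrite {1}/tjoin p_eq !join1r meet1l meet1r.
split=> // a; apply: (can_inj compl_involutive); rewrite compl_join.
have := p_eq (compl a) zero zero.
by rewrite T20 compl0 join1l join0l join0r meet1l.
Qed.

End TernaryTheory.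

Section DualFormula.
Context {A : Type} {p : A -> A -> A -> A} {zero one : A}.
Context (Hp : ternary_algebra p zero one).

Local Notation meet := (tmeet p zero).
Local Notation join := (tjoin p one).
Local Notation compl := (tcompl p zero one).

(** This is [p_join_of_meets] for the dual algebra, up to the order of the
    factors. *)
Lemma p_meet_of_joins :
  idempotent_commutative_magma join -> forall a b c,
  p a b c = meet (meet (join (compl b) c) (join b a)) (join a c).
Proof.
move=> magma_join a b c; have [joinxx joinC] := magma_join.
have [_ meetC] := magma_join_meet Hp magma_join.
have magma_dual :
    idempotent_commutative_magma (tmeet (fun a b c => p c b a) one).
  by split=> [x | x y]; [exact: joinxx | exact: joinC].
have -> : p a b c = meet (join a b) (meet (join a c) (join c (compl b))).
  exact: p_join_of_meets (ternary_dual Hp) magma_dual c b a.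
rewrite (meetC (join a c)) (joinC c) (joinC a b) (meetA Hp).
by rewrite (meetC (join b a)).
Qed.

End DualFormula.

Theorem theorem4p1 (A : Type) (p : A -> A -> A -> A) (zero one : A)
    (Hp : ternary_algebra p zero one) :
  let meet := tmeet p zero in
  let join := tjoin p one in
  let compl := tcompl p zero one in
  [<-> de_morgan_algebra join meet compl zero one;
       distributive_lattice join meet;
       semilattice join;
       semilattice meet;
       idempotent_commutative_magma join;
       idempotent_commutative_magma meet;
       (forall a b c,
          p a b c = join (join (meet (compl b) a) (meet a c)) (meet b c));
       (forall a b c,
          p a b c = meet (meet (join (compl b) c) (join b a)) (join a c))].
Proof.
move=> meet join compl; tfae.
- by case=> -[].
- by case=> -[].
- case=> _ joinC joinxx; have [] := magma_join_meet Hp (conj joinxx joinC).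
  by split=> //; exact: meetA Hp.
- by case=> _ meetC meetxx; exact: magma_meet_join Hp (conj meetxx meetC).
- exact: magma_join_meet Hp.
- exact: p_join_of_meets Hp.
- by move=> /(join_magma_of_p_eq Hp); exact: p_meet_of_joins Hp.
- by move=> /(meet_magma_of_p_eq Hp); exact: de_morgan_of_meet Hp.
Qed.
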